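(* Let $X$ and $I$ be compact metric spaces, let $\{f_t\}_{t\in I}$ be a near-isotopy of $X$ (i.e. a near-isotopy in $\mathcal{C}(X,X)$), and for each $t\in I$ let $\hat f_t\colon X_\infty^t\to X_\infty^t$ denote the natural extension of $f_t$ to the inverse limit $X_\infty^t=\varprojlim(X,f_t)$. Then for all $\epsilon>0$ there exist homeomorphisms $h_t\colon X_\infty^t\to X$, one for each $t\in I$, such that (a) $\{h_t\circ\hat f_t\circ h_t^{-1}\}_{t\in I}$ is a continuous family of homeomorphisms of $X$, and (b) $d(h_t,\pi_{0,t})<\epsilon$ for all $t\in I$, where $\pi_{0,t}\colon X_\infty^t\to X$ is projection to the $0^{\text{th}}$ coordinate. Moreover, if $X$ is a compact manifold and $\partial X$ is totally invariant under $f_t$ for all $t\in I$, then for every $t\in I$ $$\partial X_\infty^t=\{\underline{x}\in X_\infty^t : x_0\in\partial X\}.$$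
   Context: For compact metric spaces $X,Y$, $\mathcal{C}(X,Y)$ and $\mathcal{H}(X,Y)$ denote the spaces of continuous maps and of homeomorphisms $X\to Y$, with the uniform metric $d(f,g)=\sup_{x\in X} d(f(x),g(x))$. A family $\{f_t\}_{t\in I}$ in $\mathcal{C}(X,Y)$ is continuous if $t\mapsto f_t$ is continuous for the uniform metric (equivalently, $(x,t)\mapsto f_t(x)$ is continuous). $\mathbb{N}$ includes $0$. Near-isotopy: a continuous family $\{f_t\}_{t\in I}$ in $\mathcal{C}(X,Y)$, with $I$ a compact metric space, is a near-isotopy if the map $X\times I\to Y$, $(x,t)\mapsto f_t(x)$, can be uniformly approximated (arbitrarily closely) by maps of the form $(x,t)\mapsto h_t(x)$, where $\{h_t\}_{t\in I}$ is a continuous family in $\mathcal{H}(X,Y)$. Inverse limit and natural extension: for a continuous self-map $f\colon X\to X$ of a compact metric space, $\varprojlim(X,f)=\{\underline{x}=(x_0,x_1,\dots)\in X^{\mathbb{N}} : f(x_{i+1})=x_i\text{ for all }i\in\mathbb{N}\}$, as a subspace of the product $X^{\mathbb{N}}$; the natural extension of $f$ is the homeomorphism $\hat f(\underline{x})=(f(x_0),x_0,x_1,\dots)$ of $\varprojlim(X,f)$. When $X$ is a manifold (possibly with boundary), $\partial X$ is its manifold boundary, and $\partial X_\infty^t$ is the manifold boundary of $X_\infty^t$, which is a manifold since it is homeomorphic to $X$. $\partial X$ is totally invariant under $f_t$ if $f_t^{-1}(\partial X)=\partial X$, i.e. $f_t(x)\in\partial X$ if and only if $x\in\partial X$. *)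

(* Defs.v *)
From HB Require Import structures.
From mathcomp Require Import all_boot all_order all_algebra.
From mathcomp Require Import all_classical all_reals all_analysis.

Set Implicit Arguments.
Unset Strict Implicit.
Unset Printing Implicit Defensive.

Import Order.TTheory GRing.Theory Num.Theory.
Import numFieldNormedType.Exports.

Local Open Scope classical_set_scope.
Local Open Scope ring_scope.

Definition inverse_homeomorphisms {S T : topologicalType}
    (h : S -> T) (k : T -> S) : Prop :=
  [/\ continuous h, continuous k, cancel h k & cancel k h].

Definition homeomorphism {S T : topologicalType} (h : S -> T) : Prop :=
  exists k : T -> S, inverse_homeomorphisms h k.

Definition homeomorphic (S T : topologicalType) : Prop :=
  exists h : S -> T, homeomorphism h.

(* The supremum is taken in the extended reals, so that unbounded pairs of maps
   are at distance +oo and not at the default value of a real supremum.  If S is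
   empty the value is -oo instead of 0; the distance is only ever used in
   comparisons [_ < e] with e positive, on which this has no effect. *)
Definition sup_dist {R : realType} {S : Type} {Y : metricType R}
    (f g : S -> Y) : \bar R :=
  ereal_sup [set (mdist (f x) (g x))%:E | x in [set: S]].

(* For compact X and continuous maps, the topology of [{uniform X -> Y}] is the
   one induced by the sup metric. *)
Definition continuous_family {R : realType} {X Y I : metricType R}
    (f : I -> X -> Y) : Prop :=
  (forall t, continuous (f t)) /\ continuous (f : I -> {uniform X -> Y}).

Definition continuous_family_homeo {R : realType} {X Y I : metricType R}
    (f : I -> X -> Y) : Prop :=
  (forall t, homeomorphism (f t)) /\ continuous_family f.

Definition near_isotopy {R : realType} {X Y I : metricType R}
    (f : I -> X -> Y) : Prop :=
  continuous_family f /\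
  forall e : R, 0 < e ->
    exists2 h : I -> X -> Y, continuous_family_homeo h &
      (sup_dist (fun p : X * I => f p.2 p.1)
                (fun p : X * I => h p.2 p.1) < e%:E)%E.

(* Coerced to a type, this set carries the subspace topology of the product
   topology on [{ptws nat -> X}]. *)
Definition inverse_limit {X : topologicalType} (f : X -> X) :
    set {ptws nat -> X} :=
  [set x | forall i, f (x i.+1) = x i].

Definition inverse_limit_proj {X : topologicalType} (f : X -> X) (i : nat)
    (x : inverse_limit f) : X := set_val x i.
Arguments inverse_limit_proj {X} f i x.

Definition natural_extension_seq {X : topologicalType} (f : X -> X)
    (x : {ptws nat -> X}) : {ptws nat -> X} :=
  fun i => if i is j.+1 then x j else f (x 0%N).

Lemma natural_extension_subproof {X : topologicalType} (f : X -> X)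
    (x : inverse_limit f) :
  natural_extension_seq f (set_val x) \in inverse_limit f.
Proof.
by apply/mem_set; case=> [|i] //=; have /set_mem := svalP x; apply.
Qed.

Definition natural_extension {X : topologicalType} (f : X -> X)
    (x : inverse_limit f) : inverse_limit f :=
  exist (fun y => y \in inverse_limit f) _ (natural_extension_subproof x).
Arguments natural_extension {X} f x.

(* For n = 0 the condition is vacuous and the half-space is R^0. *)
Definition half_space (R : realType) (n : nat) : set 'rV[R]_n :=
  [set v | forall i : 'I_n, i.+1 = n -> 0 <= v ord0 i].
Arguments half_space : clear implicits.

(* Topological n-manifolds, possibly with boundary. *)
Definition manifold (R : realType) (n : nat) (M : topologicalType) : Prop :=
  [/\ hausdorff_space M, @second_countable M &
      forall x : M, exists (U : set M) (V : set 'rV[R]_n),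
        [/\ open U, U x, open V & homeomorphic U (V `&` half_space R n)]].

Definition manifold_interior (R : realType) (n : nat) (M : topologicalType) :
    set M :=
  [set x | exists (U : set M) (V : set 'rV[R]_n),
     [/\ open U, U x, open V & homeomorphic U V]].
Arguments manifold_interior : clear implicits.

Definition manifold_boundary (R : realType) (n : nat) (M : topologicalType) :
    set M :=
  ~` manifold_interior R n M.
Arguments manifold_boundary : clear implicits.

(* Main.v *)
(** On Z = X * I the family becomes one map F (x, t) = (f t x, t), which is a
    uniform limit of homeomorphisms preserving the second coordinate.  Brown's
    argument then applies fibrewise: choose homeomorphisms g_1, g_2, ... so
    close to F, relative to the moduli of continuity of everything chosen
    before, that with G_n = g_1 o ... o g_n both
      H x = lim G_n (x_n)   and   (K z)_j = lim F^(n - j) (G_n^-1 z)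
    converge uniformly; these are mutually inverse homeomorphisms between the
    inverse limit of F and Z, over I.  Continuity of the conjugated family in
    (x, t) is then continuity of H, K and the natural extension of F.

    The boundary is closed and invariant under homeomorphisms.  If x is a
    boundary point of the inverse limit, then so are the points h x of X, which
    tend to x_0 as epsilon tends to 0.  Conversely, if x_0 is a boundary point,
    then so is every x_n by total invariance, hence every G_n (x_n), hence
    their limit h x. *)

Require Import Defs.
From HB Require Import structures.
From mathcomp Require Import all_boot all_order all_algebra.
From mathcomp Require Import all_classical all_reals all_analysis.
From mathcomp Require Import lra.

Set Implicit Arguments.
Unset Strict Implicit.
Unset Printing Implicit Defensive.

Import Order.TTheory GRing.Theory Num.Theory.
Import numFieldNormedType.Exports.

Local Open Scope classical_set_scope.
Local Open Scope ring_scope.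

(** * Continuity, the product metric and estimates in compact metric spaces *)

Lemma comp_continuous (S T U : topologicalType) (f : S -> T) (g : T -> U) :
  continuous f -> continuous g -> continuous (g \o f).
Proof. by move=> cf cg x; apply: continuous_comp; [exact: cf|exact: cg]. Qed.

Lemma fst_continuous (S T : topologicalType) : continuous (@fst S T).
Proof. by move=> p; exact: cvg_fst. Qed.

Lemma snd_continuous (S T : topologicalType) : continuous (@snd S T).
Proof. by move=> p; exact: cvg_snd. Qed.

Lemma pairl_continuous (S T : topologicalType) (t : T) :
  continuous (fun s : S => (s, t)).
Proof. by move=> s; apply: cvg_pair; [exact: cvg_id|exact: cvg_cst]. Qed.

Section product_metric.
Context {R : realType} (X Y : metricType R).

(** The maximum is taken because its balls are those the product already carries, so the metric
    induces the existing product topology. *)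
Let dist (p q : X * Y) : R := Num.max (mdist p.1 q.1) (mdist p.2 q.2).

Let dist_ge0 p q : 0 <= dist p q.
Proof. by rewrite /dist le_max mdist_ge0. Qed.

Let dist_positivity p q : dist p q = 0 -> p = q.
Proof.
case: p q => [x y] [x' y'] /eqP.
rewrite eq_le ge_max /= => /andP[/andP[dx dy] _].
by congr pair; apply/mdist_positivity/eqP; rewrite eq_le mdist_ge0 andbT.
Qed.

Let ballEdist p d : ball p d = [set q | dist p q < d].
Proof.
apply/seteqP; split=> q;
  rewrite /dist /= /ball /= /prod_ball !ballEmdist /= gt_max.
  by case=> -> ->.
by move/andP.
Qed.

HB.instance Definition _ :=
  @PseudoMetric_isMetric.Build R (X * Y)%type dist dist_ge0 dist_positivity
    ballEdist.

Lemma mdist_prod (p q : X * Y) :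
  mdist p q = Num.max (mdist p.1 q.1) (mdist p.2 q.2).
Proof. by []. Qed.

End product_metric.

Section metric_continuity.
Context {R : realType}.

Lemma near_mdist (X : metricType R) (x : X) (e : R) :
  0 < e -> \forall y \near x, mdist x y < e.
Proof.
move=> e0; have := nbhsx_ballx x _ e0.
by rewrite ballEmdist.
Qed.

Lemma cvg_mdistP (X : metricType R) (T : Type) (F : set_system T) (f : T -> X)
    (l : X) : Filter F ->
  f @ F --> l <-> (forall e : R, 0 < e -> \forall t \near F, mdist l (f t) < e).
Proof.
move=> FF; split => [/cvg_ballP fl e /fl|fl]; first by rewrite ballEmdist.
by apply/cvg_ballP => e /fl; rewrite ballEmdist.
Qed.

Lemma uniform_approx_continuous (T : topologicalType) (X : metricType R)
    (f : T -> X) :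
  (forall e : R, 0 < e ->
     exists2 g : T -> X, continuous g & forall t, mdist (f t) (g t) <= e) ->
  continuous f.
Proof.
move=> fg t; apply/cvg_mdistP => e e0.
have e4 : 0 < e / 4 by rewrite divr_gt0.
have [g cg dfg] := fg _ e4.
have /cvg_mdistP/(_ _ e4) := cg t; apply: filterS => s gts.
have := metric_triangle (f t) (g t) (f s).
have := metric_triangle (g t) (g s) (f s).
have := dfg t; have := dfg s; rewrite (metric_sym (f s)).
by move: gts e0; lra.
Qed.

(** Near each point every small enough [d] works on a whole neighbourhood; compactness, in its
    near-covering form, yields one [d] for all points. *)
Lemma compact_continuous_modulus (X Y : metricType R) (f : X -> Y) (e : R) :
  compact [set: X] -> continuous f -> 0 < e ->
  exists2 d : R, 0 < d & forall x y, mdist x y < d -> mdist (f x) (f y) < e.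
Proof.
move=> /compact_near_coveringP cX cf e0.
have e2 : 0 < e / 2 by rewrite divr_gt0.
have : \forall d \near 0^'+, [set: X] `<=`
    [set x | forall y, mdist x y < d -> mdist (f x) (f y) < e].
  apply: cX => x _.
  have /cvg_mdistP/(_ _ e2) := cf x.
  move=> /nbhs_ballP[r /= r0]; rewrite ballEmdist => xr.
  have r2 : 0 < r / 2 by rewrite divr_gt0.
  exists ([set x' | mdist x x' < r / 2], [set d | d < r / 2]) => /=.
    by split; [exact: near_mdist|exact: nbhs_right_lt].
  case=> x' d /= [xx' dr] y x'y.
  have := metric_triangle (f x') (f x) (f y).
  have := metric_triangle x x' y.
  have := xr x'; have := xr y.
  rewrite /= (metric_sym (f x') (f x)) => h1 h2 h3 h4.
  move: xx' dr x'y => /= xx' dr x'y.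
  have {}h1 : mdist (f x) (f y) < e / 2 by apply: h1; lra.
  have {}h2 : mdist (f x) (f x') < e / 2 by apply: h2; lra.
  lra.
move=> cov.
have := @nbhs_right_gt R 0; move: cov => /filterI/[apply] => cov.
have [d [dP d0]] := @filter_ex _ _ _ _ cov.
by exists d => // x y; exact: (dP x).
Qed.

Lemma compact_continuous_moduli (X Y : metricType R) (f : nat -> X -> Y)
    (e : R) n :
  compact [set: X] -> (forall i, continuous (f i)) -> 0 < e ->
  exists2 d : R, 0 < d &
    forall i x y, (i <= n)%N -> mdist x y < d -> mdist (f i x) (f i y) < e.
Proof.
move=> cX cf e0; elim: n => [|n [d d0 dP]].
  have [d d0 dP] := compact_continuous_modulus cX (cf 0%N) e0.
  by exists d => // i x y; rewrite leqn0 => /eqP ->; exact: dP.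
have [d' d'0 d'P] := compact_continuous_modulus cX (cf n.+1) e0.
exists (Num.min d d') => [|i x y]; first by rewrite lt_min d0.
rewrite leq_eqVlt lt_min => /predU1P[->|/dP dxy] /andP[xyd xyd'].
  exact: d'P.
exact: dxy.
Qed.

(** Since [d n <= 2 * d n - 2 * d n.+1], the distances telescope. The limit is a cluster point,
    provided by compactness, which inherits the closed bounds. *)
Lemma geometric_cvg (X : metricType R) (x : nat -> X) (d : nat -> R) :
  compact [set: X] -> (forall n, 2 * d n.+1 <= d n) ->
  (forall n, mdist (x n) (x n.+1) <= d n) ->
  exists l, forall n, mdist l (x n) <= 2 * d n.
Proof.
move=> cX dS xd.
have xnm n k : mdist (x n) (x (n + k)%N) <= 2 * d n - 2 * d (n + k)%N.
  elim: k => [|k IH]; first by rewrite addn0 mdistxx subrr.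
  rewrite addnS; have := metric_triangle (x n) (x (n + k)%N) (x (n + k).+1).
  have := xd (n + k)%N; have := dS (n + k)%N; lra.
have d0 n : 0 <= d n by apply: le_trans (xd n); exact: mdist_ge0.
have [l [_ lx]] := cX (x @ \oo) _ filterT.
exists l => n; apply/ler_addgt0Pl => e e0.
have xn : \forall m \near \oo, mdist (x n) (x m) <= 2 * d n.
  apply: filterS (nbhs_infty_ge n) => m nm; rewrite -(subnKC nm).
  by have := xnm n (m - n)%N; have := d0 (n + (m - n))%N; lra.
have [y [/= yn yl]] :=
  lx [set y | mdist (x n) y <= 2 * d n] _ xn (near_mdist l e0).
have := metric_triangle l y (x n); rewrite (metric_sym y); lra.
Qed.

End metric_continuity.

Lemma mdist_le_eq {R : realType} (X : metricType R) (x y : X) :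
  (forall e : R, 0 < e -> mdist x y <= e) -> x = y.
Proof.
move=> xy; apply/mdist_positivity/eqP; rewrite eq_le mdist_ge0 andbT.
by apply/ler_addgt0Pl => e e0; rewrite addr0 xy.
Qed.

(** * Topology of inverse limits and composition of homeomorphisms *)

Section inverse_limit_topology.
Context {X : topologicalType} (f : X -> X).

Lemma inverse_limit_projS i (x : inverse_limit f) :
  f (inverse_limit_proj f i.+1 x) = inverse_limit_proj f i x.
Proof. by have /set_mem := svalP x; exact. Qed.

Lemma inverse_limit_proj_iter i j (x : inverse_limit f) :
  iter i f (inverse_limit_proj f (i + j)%N x) = inverse_limit_proj f j x.
Proof. by elim: i => // i IH; rewrite iterSr addSn inverse_limit_projS. Qed.

Lemma inverse_limit_proj_inj (x y : inverse_limit f) :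
  (forall i, inverse_limit_proj f i x = inverse_limit_proj f i y) -> x = y.
Proof. by move=> xy; apply/val_inj/funext. Qed.

Lemma inverse_limit_proj_continuous i : continuous (inverse_limit_proj f i).
Proof.
apply: (@comp_continuous _ _ _ set_val (fun y : {ptws nat -> X} => y i)).
  exact: initial_continuous.
exact: (@proj_continuous nat (fun=> X) i).
Qed.

Lemma continuous_into_inverse_limit (S : topologicalType)
    (u : S -> inverse_limit f) :
  (forall i, continuous (inverse_limit_proj f i \o u)) -> continuous u.
Proof.
move=> cu; apply: (@continuous_comp_initial _ _ _ set_val).
move=> s; apply/cvg_sup => i.
exact: (@continuous_comp_initial _ _ _ (fun y : nat -> X => y i)
  (set_val \o u) (cu i)).
Qed.

End inverse_limit_topology.

Lemma inverse_homeomorphisms_id (S : topologicalType) :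
  inverse_homeomorphisms (@id S) id.
Proof. by split => // x; exact: cvg_id. Qed.

Lemma inverse_homeomorphisms_comp (S T U : topologicalType)
    (h : S -> T) (h' : T -> S) (k : T -> U) (k' : U -> T) :
  inverse_homeomorphisms h h' -> inverse_homeomorphisms k k' ->
  inverse_homeomorphisms (k \o h) (h' \o k').
Proof.
move=> [ch ch' hK h'K] [ck ck' kK k'K]; split.
- exact: comp_continuous ch ck.
- exact: comp_continuous ck' ch'.
- exact: can_comp.
- exact: can_comp.
Qed.

Lemma inverse_homeomorphisms_sym (S T : topologicalType) (h : S -> T)
    (k : T -> S) : inverse_homeomorphisms h k -> inverse_homeomorphisms k h.
Proof. by case. Qed.

(** * Brown's approximation argument for fibre-preserving homeomorphisms *)

Section fibred_brown.
Context {R : realType} (Z : metricType R) (B : Type) (p : Z -> B) (f : Z -> Z)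
  (cptZ : compact [set: Z]) (cf : continuous f)
  (near_f : forall e : R, 0 < e ->
     exists2 g : Z -> Z, homeomorphism g /\ (forall z, p (g z) = p z) &
       forall z, mdist (f z) (g z) < e).

Let iter_continuous i : continuous (iter i f).
Proof.
elim: i => [|i IH]; first by move=> z; exact: cvg_id.
exact: comp_continuous IH cf.
Qed.

(* The n-th stage of Brown's construction: G_n, its inverse and a tolerance d_n.
   As d_(n+1) <= d_n / 2, all later changes add up to at most 2 * d_n. *)
Record stage := Stage {
  stage_index : nat;
  stage_homeo : Z -> Z;
  stage_inverse : Z -> Z;
  stage_tolerance : R;
  stage_homeoP : inverse_homeomorphisms stage_homeo stage_inverse;
  stage_homeo_fibre : forall z, p (stage_homeo z) = p z;
  stage_tolerance_gt0 : 0 < stage_tolerance;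
  stage_tolerance_le : 2 * stage_tolerance <= stage_index.+1%:R^-1;
  stage_homeo_modulus : forall a b, mdist a b <= 2 * stage_tolerance ->
    mdist (stage_homeo a) (stage_homeo b) < stage_index.+1%:R^-1;
  stage_inverse_modulus : forall i a b, (i <= stage_index)%N ->
    mdist a b <= 2 * stage_tolerance ->
    mdist (iter i f (stage_inverse a)) (iter i f (stage_inverse b))
      < stage_index.+1%:R^-1 }.

Lemma exists_stage n (g g' : Z -> Z) (e : R) :
  inverse_homeomorphisms g g' -> (forall z, p (g z) = p z) -> 0 < e ->
  exists s : stage,
    [/\ stage_index s = n, stage_homeo s = g, stage_inverse s = g' &
        stage_tolerance s <= e].
Proof.
move=> gP gp e0; have [cg cg' _ _] := gP.
have n0 : 0 < n.+1%:R^-1 :> R by rewrite invr_gt0.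
(* [phi] lists $g$ and then the maps $f^j \circ g^{-1}$, so that a single modulus serves both
   modulus fields of the stage. *)
pose phi i := if i is j.+1 then iter j f \o g' else g.
have cphi i : continuous (phi i).
  case: i => [|i]; first exact: cg.
  exact: comp_continuous cg' (@iter_continuous i).
have [d d0 dP] := compact_continuous_moduli n.+1 cptZ cphi n0.
(* The three bounds serve, in order, the required decay, [stage_tolerance_le] and the moduli;
   [d / 3] keeps [2 * t] strictly below [d]. *)
pose t := Num.min e (Num.min (n.+1%:R^-1 / 2) (d / 3)).
have t0 : 0 < t by rewrite !lt_min e0 !divr_gt0.
have tn : 2 * t <= n.+1%:R^-1.
  by rewrite mulrC -ler_pdivlMr// !ge_min lexx orbT.
have td : 2 * t < d.
  have : t <= d / 3 by rewrite !ge_min lexx !orbT.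
  lra.
have gM a b : mdist a b <= 2 * t -> mdist (g a) (g b) < n.+1%:R^-1.
  by move=> ab; apply: (dP 0%N) => //; exact: le_lt_trans td.
have g'M i a b : (i <= n)%N -> mdist a b <= 2 * t ->
    mdist (iter i f (g' a)) (iter i f (g' b)) < n.+1%:R^-1.
  by move=> ni ab; apply: (dP i.+1) => //; exact: le_lt_trans td.
exists (Stage gP gp t0 tn gM g'M); split => //=.
by rewrite ge_min lexx.
Qed.

(** At $z = x_{n+1}$ the third clause bounds the step from $G_n(x_n)$ to $G_{n+1}(x_{n+1})$; with $i
    = n - j$ the last one bounds the step between consecutive approximations of $(K y)_j$. *)
Definition refines (s s' : stage) : Prop :=
  [/\ stage_index s' = (stage_index s).+1,
      2 * stage_tolerance s' <= stage_tolerance s,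
      forall z,
        mdist (stage_homeo s (f z)) (stage_homeo s' z) <= stage_tolerance s &
      forall i y, (i <= stage_index s)%N ->
        mdist (iter i f (stage_inverse s y)) (iter i.+1 f (stage_inverse s' y))
          <= stage_tolerance s].

(** Take $G_{n+1} = G_n \circ g$ with $g$ within [d] of $f$, where [d] is a modulus, at the current
    tolerance, for $G_n$ and for the iterates $f^i$ with $i \le n$. *)
Lemma exists_refinement (s : stage) : exists s', refines s s'.
Proof.
have [cG cG' GK G'K] := stage_homeoP s.
have t0 := stage_tolerance_gt0 s.
pose phi i := if i is j.+1 then iter j f else stage_homeo s.
have cphi i : continuous (phi i).
  by case: i => [|i]; [exact: cG|exact: iter_continuous].
have [d d0 dP] := compact_continuous_moduli (stage_index s).+1 cptZ cphi t0.
have [g [[g' gP] gp] fg] := near_f d0.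
have [_ _ gK g'K] := gP.
have t2 : 0 < stage_tolerance s / 2 by rewrite divr_gt0.
have [|s' [s'n s'G s'G' s't]] := @exists_stage (stage_index s).+1 _ _ _
  (inverse_homeomorphisms_comp gP (stage_homeoP s)) _ t2.
  by move=> z /=; rewrite stage_homeo_fibre gp.
exists s'; split => //.
- lra.
- by move=> z; rewrite s'G /=; apply/ltW/(dP 0%N).
- move=> i y si; rewrite s'G' /= -iterS iterSr metric_sym.
  (* With $w = G_{n+1}^{-1} y$ one has $G_n^{-1} y = g(w)$, so the claim compares $f^i(g(w))$ with
     $f^i(f(w))$. *)
  by rewrite -{2}(g'K (stage_inverse s y)); apply/ltW/(dP i.+1).
Qed.

Lemma fibred_brown (e : R) : 0 < e ->
  exists (H : inverse_limit f -> Z) (K : Z -> inverse_limit f)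
         (G : nat -> Z -> Z),
    [/\ inverse_homeomorphisms H K,
        forall x, mdist (H x) (inverse_limit_proj f 0%N x) < e,
        forall n, homeomorphism (G n) /\ (forall z, p (G n z) = p z) &
        forall x, G n (inverse_limit_proj f n x) @[n --> \oo] --> H x].
Proof.
move=> e0.
(* As $G_0$ is the identity, $H x$ will be within $2 d_0 \le e / 2$ of $x_0$. *)
have e4 : 0 < e / 4 by rewrite divr_gt0.
have [s0 [s0n s0G s0G' s0t]] :=
  @exists_stage 0%N _ _ _ (inverse_homeomorphisms_id Z) (fun=> erefl) e4.
have [s [ss0 sS]] := dependent_choice (fun s => cid (exists_refinement s)) s0.
pose G n := stage_homeo (s n); pose G' n := stage_inverse (s n).
pose d n := stage_tolerance (s n); pose eps n : R := n.+1%:R^-1.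
have sn n : stage_index (s n) = n.
  by elim: n => [|n IH]; [rewrite ss0|have [-> _ _ _] := sS n; rewrite IH].
have cG n : continuous (G n).
  by have [c _ _ _] := stage_homeoP (s n); exact: c.
have cG' n : continuous (G' n).
  by have [_ c _ _] := stage_homeoP (s n); exact: c.
have GK n : cancel (G n) (G' n).
  by have [_ _ c _] := stage_homeoP (s n); exact: c.
have G'K n : cancel (G' n) (G n).
  by have [_ _ _ c] := stage_homeoP (s n); exact: c.
have dS n : 2 * d n.+1 <= d n by have [] := sS n.
have d_eps n : 2 * d n <= eps n by rewrite /eps -{2}(sn n) stage_tolerance_le.
have GS n z : mdist (G n (f z)) (G n.+1 z) <= d n.
  by have [_ _ + _] := sS n; exact.
have G'S n i y : (i <= n)%N ->
    mdist (iter i f (G' n y)) (iter i.+1 f (G' n.+1 y)) <= d n.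
  by move=> ni; have [_ _ _] := sS n; apply; rewrite sn.
have GM n a b : mdist a b <= 2 * d n -> mdist (G n a) (G n b) < eps n.
  by move=> ab; rewrite /eps -{3}(sn n); exact: stage_homeo_modulus.
have G'M n i a b : (i <= n)%N -> mdist a b <= 2 * d n ->
    mdist (iter i f (G' n a)) (iter i f (G' n b)) < eps n.
  move=> ni ab; rewrite /eps -{3}(sn n).
  by apply: stage_inverse_modulus; rewrite ?sn.
have eps_small (r : R) : 0 < r -> \forall n \near \oo, eps n < r.
  by move=> r0; exact: (near_infty_natSinv_lt (PosNum r0)).
have Hlim x : exists l, forall n,
    mdist l (G n (inverse_limit_proj f n x)) <= 2 * d n.
  apply: geometric_cvg => // n.
  by rewrite -(inverse_limit_projS n); exact: GS.
have [H HP] := choice Hlim.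
(* Coordinate $j$ of $K y$ is approximated by $m$ iterates from stage $m + j$, which keeps $m$
   within the range controlled by that stage. *)
have Llim (yj : Z * nat) : exists l, forall m,
    mdist l (iter m f (G' (m + yj.2)%N yj.1)) <= 2 * d (m + yj.2)%N.
  apply: geometric_cvg => // m.
    exact: dS.
  by apply: G'S; exact: leq_addr.
have [L LP] := choice Llim.
have Lf y j : f (L (y, j.+1)) = L (y, j).
  (* Stage $m + j + 1$ approximates coordinate $j + 1$ by $m$ iterates and coordinate $j$ by one
     more, so $f$ carries the first approximation to the second. *)
  apply: mdist_le_eq => r r0.
  have r2 : 0 < r / 2 by rewrite divr_gt0.
  have [q q0 qP] := compact_continuous_modulus cptZ cf r2.
  have rq : 0 < Num.min (r / 2) q by rewrite lt_min r2.
  have [m _ /(_ m (leqnn m))] := eps_small _ rq; rewrite lt_min => /andP[mr mq].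
  have em k : eps (m + k)%N <= eps m.
    by rewrite /eps lef_pV2 ?posrE// ler_nat ltnS leq_addr.
  have := LP (y, j.+1) m; have := LP (y, j) m.+1.
  rewrite /= addSnnS => h1 h2.
  have := qP (L (y, j.+1)) (iter m f (G' (m + j.+1)%N y)).
  have := metric_triangle (f (L (y, j.+1))) (f (iter m f (G' (m + j.+1)%N y)))
    (L (y, j)).
  rewrite (metric_sym (f (iter m _ _))).
  have := d_eps (m + j.+1)%N; have := em j.+1 => h3 h4 h5 h6.
  have {}h6 := h6 ltac:(lra).
  lra.
have KP y : (fun j => L (y, j)) \in inverse_limit f.
  by apply/mem_set => j; exact: Lf.
pose K y : inverse_limit f := exist (fun x => x \in inverse_limit f) _ (KP y).
have KE y j : inverse_limit_proj f j (K y) = L (y, j) by [].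
exists H, K, G; split; last first.
- move=> x; apply/cvg_mdistP => r /eps_small; apply: filterS => n nr.
  by have := HP x n; have := d_eps n; lra.
- move=> n; split; last exact: stage_homeo_fibre.
  by exists (G' n); exact: stage_homeoP.
- move=> x; have := HP x 0%N; rewrite /G ss0 s0G /=.
  have : d 0%N <= e / 4 by rewrite /d ss0.
  lra.
(* From a stage $n \ge j$, coordinate $j$ is reached by $n - j$ iterates; the factor 2 leaves room
   for two errors of size [eps n]. *)
have eps_le (r : R) j : 0 < r -> exists2 n, (j <= n)%N & 2 * eps n < r.
  move=> r0; have r2 : 0 < r / 2 by rewrite divr_gt0.
  have [n [nr jn]] := filter_ex (filterI (eps_small _ r2) (nbhs_infty_ge j)).
  by exists n => //; lra.
split.
- apply: uniform_approx_continuous => r /(eps_le _ 0%N)[n _ nr].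
  exists (G n \o inverse_limit_proj f n) => [|x].
    exact: comp_continuous (@inverse_limit_proj_continuous _ f n) (cG n).
  have := HP x n; have := d_eps n; have : 0 < eps n by rewrite invr_gt0.
  by rewrite /=; lra.
- apply: continuous_into_inverse_limit => j.
  apply: uniform_approx_continuous => r /(eps_le _ j)[n jn nr].
  exists (iter (n - j)%N f \o G' n) => [|y].
    exact: comp_continuous (cG' n) (@iter_continuous _).
  have := LP (y, j) (n - j)%N; rewrite /= subnK// KE.
  have := d_eps n; have : 0 < eps n by rewrite invr_gt0.
  lra.
(* $H x$ is within $2 d_n$ of $G_n(x_n)$, so the modulus of $f^{n-j} \circ G_n^{-1}$ puts
   $f^{n-j}(G_n^{-1}(H x))$ near $f^{n-j}(x_n) = x_j$. *)
- move=> x; apply: inverse_limit_proj_inj => j; rewrite KE.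
  apply: mdist_le_eq => r /(eps_le _ j)[n jn nr].
  have := LP (H x, j) (n - j)%N; rewrite /= subnK// => h1.
  have := G'M n (n - j)%N _ _ (leq_subr _ _) (HP x n).
  have := inverse_limit_proj_iter (n - j) j x.
  rewrite GK subnK// => -> h2.
  have := metric_triangle (L (H x, j)) (iter (n - j) f (G' n (H x)))
    (inverse_limit_proj f j x).
  by have := d_eps n; lra.
(* By the case of zero iterates, $(K y)_n$ is within $2 d_n$ of $G_n^{-1} y$, so the modulus of
   $G_n$ puts $G_n((K y)_n)$, which is near $H(K y)$, near $y$ as well. *)
- move=> y; apply: mdist_le_eq => r /(eps_le _ 0%N)[n _ nr].
  have := HP (K y) n; rewrite KE => h1.
  have := GM n _ _ (LP (y, n) 0%N); rewrite /= G'K => h2.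
  have := metric_triangle (H (K y)) (G n (L (y, n))) y.
  by have := d_eps n; lra.
Qed.

End fibred_brown.

(** * Inverses on compact spaces and the natural extension *)

Lemma compact_inverse_continuous (S T : topologicalType) (h : S -> T)
    (k : T -> S) : compact [set: S] -> hausdorff_space T -> continuous h ->
  cancel h k -> cancel k h -> continuous k.
Proof.
move=> cS hT ch hK kK; apply/continuous_closedP => A cA.
(* Preimages under [k] are images under [h], and these are compact, hence closed. *)
have -> : k @^-1` A = h @` A.
  apply/seteqP; split => [t At|t [s As <-]]; first by exists (k t).
  by rewrite /= hK.
apply: compact_closed => //; apply: continuous_compact.
  by apply: continuous_subspaceT => s; exact: ch.
exact: subclosed_compact cS _.
Qed.

Section natural_extension.
Context {X : topologicalType} (f : X -> X).

Lemma natural_extension_proj0 x :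
  inverse_limit_proj f 0%N (natural_extension f x) =
  f (inverse_limit_proj f 0%N x).
Proof. by []. Qed.

Lemma inverse_limit_shift_subproof (x : inverse_limit f) :
  (fun i => inverse_limit_proj f i.+1 x) \in inverse_limit f.
Proof. by apply/mem_set => i; exact: inverse_limit_projS. Qed.

Definition inverse_limit_shift (x : inverse_limit f) : inverse_limit f :=
  exist (fun y => y \in inverse_limit f) _ (inverse_limit_shift_subproof x).

Lemma natural_extension_homeo : continuous f ->
  inverse_homeomorphisms (natural_extension f) inverse_limit_shift.
Proof.
move=> cf; split.
- apply: continuous_into_inverse_limit => -[|i].
    exact: comp_continuous (@inverse_limit_proj_continuous _ f 0%N) cf.
  exact: inverse_limit_proj_continuous.
- apply: continuous_into_inverse_limit => i.
  exact: inverse_limit_proj_continuous.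
- by move=> x; exact: inverse_limit_proj_inj.
- move=> x; apply: inverse_limit_proj_inj => -[|i] //.
  by rewrite natural_extension_proj0 inverse_limit_projS.
Qed.

End natural_extension.

(** * Topological invariance and closedness of the manifold boundary *)

Section manifold_boundary_homeo.
Context {R : realType} (n : nat).

(** The restriction of [h] carries $h^{-1}(U)$ homeomorphically onto [U], so a Euclidean chart at
    [h x] composes with it to one at [x]. *)
Let interior_homeo (S T : topologicalType) (h : S -> T) (k : T -> S) (x : S) :
  inverse_homeomorphisms h k ->
  manifold_interior R n T (h x) -> manifold_interior R n S x.
Proof.
move=> [ch ck hK kK] [U [V [oU Uhx oV [phi [psi phiP]]]]].
exists (h @^-1` U), V; split => //.
  by apply: open_comp => // s _; exact: ch.
have hU (s : (h @^-1` U)) : h (set_val s) \in U.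
  by have /set_mem := svalP s; exact: mem_set.
have kU (t : U) : k (set_val t) \in h @^-1` U.
  by apply/mem_set; rewrite /= kK; have /set_mem := svalP t.
pose h' s : U := exist (fun t => t \in U) _ (hU s).
pose k' t : (h @^-1` U) := exist (fun s => s \in h @^-1` U) _ (kU t).
exists (phi \o h'), (k' \o psi); apply: inverse_homeomorphisms_comp phiP.
split.
- apply: (@continuous_comp_initial _ _ _ set_val).
  exact: comp_continuous (@initial_continuous _ _ set_val) ch.
- apply: (@continuous_comp_initial _ _ _ set_val).
  exact: comp_continuous (@initial_continuous _ _ set_val) ck.
- by move=> s; apply: val_inj; exact: hK.
- by move=> t; apply: val_inj; exact: kK.
Qed.

Lemma manifold_boundary_homeo (S T : topologicalType) (h : S -> T) (x : S) :
  homeomorphism h ->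
  manifold_boundary R n T (h x) <-> manifold_boundary R n S x.
Proof.
move=> [k hk]; split=> bx ix; apply: bx.
  have [_ _ hK _] := hk; rewrite -(hK x) in ix.
  exact: interior_homeo (inverse_homeomorphisms_sym hk) ix.
exact: interior_homeo hk ix.
Qed.

Lemma closed_manifold_boundary (S : topologicalType) :
  closed (manifold_boundary R n S).
Proof.
apply: open_closedC; rewrite openE => x [U [V [oU Ux oV UV]]].
by apply: filterS (open_nbhs_nbhs (conj oU Ux)) => y Uy; exists U, V.
Qed.

End manifold_boundary_homeo.

(** * Continuous families as continuous maps on the product *)

Section families.
Context {R : realType}.

Lemma sup_dist_lt (S : Type) (Y : metricType R) (f g : S -> Y) (e : R) x :
  (sup_dist f g < e%:E)%E -> mdist (f x) (g x) < e.
Proof.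
move=> fg; rewrite -lte_fin; apply: le_lt_trans fg.
by apply: ereal_sup_ubound; exists x.
Qed.

Lemma sup_dist_le (S : Type) (Y : metricType R) (f g : S -> Y) (e : R) :
  (forall x, mdist (f x) (g x) <= e) -> (sup_dist f g <= e%:E)%E.
Proof.
by move=> fg; apply: ge_ereal_sup => _ [x _ <-]; rewrite lee_fin.
Qed.

Context {X Y I : metricType R}.

Lemma continuous_family_uncurry (f : I -> X -> Y) : continuous_family f ->
  continuous (fun p : X * I => f p.2 p.1).
Proof.
move=> [cft cf] [x t]; apply/cvg_mdistP => e e0 /=.
have e2 : 0 < e / 2 by rewrite divr_gt0.
have /cvg_mdistP/(_ _ e2) ftx := cft t x.
have : \forall s \near t, forall y, mdist (f t y) (f s y) < e / 2.
  apply: (cf t [set g | forall y, mdist (f t y) (g y) < e / 2]).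
  apply/uniform_nbhs; exists [set yz : Y * Y | mdist yz.1 yz.2 < e / 2].
  split; last by move=> g /= fg y; exact: fg.
  rewrite -entourage_ballE; exists (e / 2) => //= -[y z] /=.
  by rewrite ballEmdist.
move=> fts; exists ([set y | mdist (f t x) (f t y) < e / 2],
  [set s | forall y, mdist (f t y) (f s y) < e / 2]) => //= -[y s] /= [xy ts].
have := metric_triangle (f t x) (f t y) (f s y).
have := ts y; lra.
Qed.

(** Uniform continuity on the compact product bounds the effect of a change of parameter for all
    points at once. *)
Lemma uncurry_continuous_family (f : I -> X -> Y) :
  compact [set: X] -> compact [set: I] ->
  continuous (fun p : X * I => f p.2 p.1) -> continuous_family f.
Proof.
move=> cX cI cf; split.
  by move=> t; exact: comp_continuous (@pairl_continuous _ _ t) cf.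
have cXI : compact [set: X * I] by rewrite -setXTT; exact: compact_setX.
move=> t P /uniform_nbhs[E [+ EP]]; rewrite -entourage_ballE => -[e /= e0 eE].
have [d d0 dP] := compact_continuous_modulus cXI cf e0.
apply: filterS (near_mdist t d0) => s ts; apply: EP => y _; apply: eE => /=.
rewrite ballEmdist /=; apply: (dP (y, t) (y, s)).
by rewrite mdist_prod /= mdistxx gt_max d0.
Qed.

End families.

(** * The total map on the product and its fibres *)

Section total_map.
Context {R : realType} {X I : metricType R}.

Definition total_map (f : I -> X -> X) (p : X * I) : X * I := (f p.2 p.1, p.2).

Lemma total_map_continuous (f : I -> X -> X) :
  continuous_family f -> continuous (total_map f).
Proof.
move=> cf p; apply: cvg_pair; first exact: (continuous_family_uncurry cf).
exact: cvg_snd.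
Qed.

(** The inverses are chosen separately for each [t], with no control as [t] varies; their joint
    continuity comes from compactness of $X \times I$. *)
Lemma total_map_homeo (f : I -> X -> X) :
  compact [set: X] -> compact [set: I] ->
  continuous_family_homeo f -> homeomorphism (total_map f).
Proof.
move=> cX cI [/choice[k fk] cf].
have cXI : compact [set: X * I] by rewrite -setXTT; exact: compact_setX.
have fK : cancel (total_map f) (total_map k).
  by move=> [x t]; have [_ _ K _] := fk t; rewrite /total_map /= K.
have kK : cancel (total_map k) (total_map f).
  by move=> [x t]; have [_ _ _ K] := fk t; rewrite /total_map /= K.
exists (total_map k); split => //; first exact: total_map_continuous.
apply: compact_inverse_continuous fK kK => //; first exact: metric_hausdorff.
exact: total_map_continuous.
Qed.

End total_map.

Section near_isotopy_inverse_limit.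
Context {R : realType} {X I : metricType R} (cptX : compact [set: X])
  (cptI : compact [set: I]) (f : I -> X -> X).

Let lift_subproof t (x : inverse_limit (f t)) :
  (fun i => (inverse_limit_proj (f t) i x, t)) \in inverse_limit (total_map f).
Proof.
by apply/mem_set => i; rewrite /total_map inverse_limit_projS.
Qed.

(** Appending the constant parameter embeds the limit of [f t] as the fibre over [t] of the limit of
    the total map. *)
Let lift t (x : inverse_limit (f t)) : inverse_limit (total_map f) :=
  exist (fun z => z \in inverse_limit (total_map f)) _ (lift_subproof x).

Let lift_continuous t : continuous (@lift t).
Proof.
apply: continuous_into_inverse_limit => i.
apply: comp_continuous (@pairl_continuous _ _ t).
exact: inverse_limit_proj_continuous.
Qed.

Let lift_natural_extension t (x : inverse_limit (f t)) :
  lift (natural_extension (f t) x) = natural_extension (total_map f) (lift x).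
Proof. by apply: inverse_limit_proj_inj => -[|i]. Qed.

Let total_proj_snd (z : inverse_limit (total_map f)) i :
  (inverse_limit_proj (total_map f) i z).2 =
  (inverse_limit_proj (total_map f) 0%N z).2.
Proof. by elim: i => // i <-; rewrite -[in RHS]inverse_limit_projS. Qed.

(** This is the fibrewise form of [fibred_brown] for the total map. The [G n t] are returned too,
    because the boundary argument follows points through them. *)
Lemma near_isotopy_inverse_limit (e : R) : near_isotopy f -> 0 < e ->
  exists (h : forall t, inverse_limit (f t) -> X)
         (k : forall t, X -> inverse_limit (f t)) (G : nat -> I -> X -> X),
    [/\ forall t, inverse_homeomorphisms (h t) (k t),
        continuous_family_homeo
          (fun t => h t \o natural_extension (f t) \o k t),
        forall t x, mdist (h t x) (inverse_limit_proj (f t) 0%N x) < e,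
        forall n t, homeomorphism (G n t) &
        forall t x,
          G n t (inverse_limit_proj (f t) n x) @[n --> \oo] --> h t x].
Proof.
move=> [cf nearf] e0.
have cZ : compact [set: X * I] by rewrite -setXTT; exact: compact_setX.
have cF := total_map_continuous cf.
have nearF r : 0 < r -> exists2 g : X * I -> X * I,
    homeomorphism g /\ (forall z, (g z).2 = z.2) &
    forall z, mdist (total_map f z) (g z) < r.
  move=> r0; have [g cg fg] := nearf _ r0.
  exists (total_map g); first by split=> //; exact: total_map_homeo.
  by move=> z; rewrite mdist_prod /= mdistxx gt_max r0 andbT (sup_dist_lt z fg).
have [H [K [G [HK He Ghomeo GH]]]] := fibred_brown cZ cF nearF e0.
have [cH cK HKK KHK] := HK.
have G2 n z : (G n z).2 = z.2 by have [_] := Ghomeo n.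
(* Each $G_n$ keeps the parameter, so the parameters along the sequence converging to [H z] are
   constant. *)
have H2 z : (H z).2 = (inverse_limit_proj (total_map f) 0%N z).2.
  have H2cvg : (G n (inverse_limit_proj (total_map f) n z)).2
      @[n --> \oo] --> (H z).2.
    by apply: (cvg_comp _ _ (GH z)); exact: snd_continuous.
  apply: (cvg_unique (@metric_hausdorff _ I) H2cvg).
  rewrite (_ : (fun n => _) = fun=> (inverse_limit_proj (total_map f) 0%N z).2).
    exact: cvg_cst.
  by apply/funext => n; rewrite G2 total_proj_snd.
pose h t (x : inverse_limit (f t)) : X := (H (lift x)).1.
(* [K (y, t)] lies over [t] because $H$ preserves parameters and inverts $K$; its first components
   thus form a point of the limit of [f t]. *)
have K2 y t i : (inverse_limit_proj (total_map f) i (K (y, t))).2 = t.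
  by rewrite total_proj_snd -H2 KHK.
have kP t y : (fun i => (inverse_limit_proj (total_map f) i (K (y, t))).1) \in
    inverse_limit (f t).
  by apply/mem_set => i; rewrite -(inverse_limit_projS i) /total_map /= K2.
pose k t y : inverse_limit (f t) :=
  exist (fun x => x \in inverse_limit (f t)) _ (kP t y).
have liftk t y : lift (k t y) = K (y, t).
  apply: inverse_limit_proj_inj => i.
  by rewrite [RHS]surjective_pairing K2.
have Hlift t (x : inverse_limit (f t)) : H (lift x) = (h t x, t).
  by rewrite [LHS]surjective_pairing H2.
have hk t : inverse_homeomorphisms (h t) (k t).
  split.
  - apply: comp_continuous (@fst_continuous _ _).
    exact: comp_continuous (@lift_continuous t) cH.
  - apply: continuous_into_inverse_limit => i.
    apply: (@comp_continuous _ _ _ _ fst _ (@fst_continuous _ _)).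
    apply: comp_continuous (@inverse_limit_proj_continuous _ _ i).
    exact: comp_continuous (@pairl_continuous _ _ t) cK.
  - move=> x; apply: inverse_limit_proj_inj => i.
    have : K (h t x, t) = lift x by rewrite -Hlift HKK.
    by move=> /(congr1 (inverse_limit_proj (total_map f) i))/(congr1 fst).
  - by move=> y; rewrite /h liftk KHK.
exists h, k, (fun n t x => (G n (x, t)).1); split => //.
- split.
    move=> t; exists (h t \o inverse_limit_shift (f := f t) \o k t).
    have := inverse_homeomorphisms_sym (hk t).
    move=> /inverse_homeomorphisms_comp/(_ (natural_extension_homeo _)).
    move=> /(_ (cf.1 t))/inverse_homeomorphisms_comp/(_ (hk t)).
    exact.
  apply: uncurry_continuous_family => //.
  (* The conjugates for all [t] together are the first component of one continuous map on $X \times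
     I$. *)
  rewrite (_ : (fun p => _) =
      fst \o H \o natural_extension (total_map f) \o K); last first.
    by apply/funext => -[y t]; rewrite /= /h lift_natural_extension liftk.
  apply: comp_continuous cK _; apply: comp_continuous.
    by have [c _ _ _] := natural_extension_homeo cF; exact: c.
  exact: comp_continuous cH (@fst_continuous _ _).
- move=> t x; have := He (lift x); rewrite Hlift mdist_prod /=.
  by rewrite gt_max => /andP[].
- move=> n t; have [[g' [cG cg' GK gK]] _] := Ghomeo n.
  (* The inverse keeps the parameter too, so fixing [t] leaves mutually inverse maps of [X]. *)
  have g'2 z : (g' z).2 = z.2 by rewrite -[in RHS](gK z) G2.
  have section_continuous (g : X * I -> X * I) : continuous g ->
      continuous (fun x => (g (x, t)).1).
    move=> cg; apply: (@comp_continuous _ _ _ _ fst _ (@fst_continuous _ _)).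
    exact: comp_continuous (@pairl_continuous _ _ t) cg.
  have section_cancel (g1 g2 : X * I -> X * I) : (forall z, (g1 z).2 = z.2) ->
      cancel g1 g2 -> cancel (fun x => (g1 (x, t)).1) (fun x => (g2 (x, t)).1).
    move=> g1E gg x; rewrite -[RHS]/((x, t).1) -[in RHS](gg (x, t)).
    by rewrite [X in _ = (g2 X).1]surjective_pairing g1E.
  exists (fun y => (g' (y, t)).1); split.
  + exact: section_continuous.
  + exact: section_continuous.
  + exact: section_cancel.
  + exact: section_cancel.
- move=> t x; apply: (cvg_comp _ _ (GH (lift x))).
  exact: fst_continuous.
Qed.

End near_isotopy_inverse_limit.

Theorem corollary2p3 (R : realType) (X I : metricType R)
    (cptX : compact [set: X]) (cptI : compact [set: I])
    (f : I -> X -> X) (nif : near_isotopy f) :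
  (forall e : R, 0 < e ->
     exists (h : forall t : I, inverse_limit (f t) -> X)
            (k : forall t : I, X -> inverse_limit (f t)),
       [/\ forall t, inverse_homeomorphisms (h t) (k t),
           continuous_family_homeo
             (fun t => h t \o natural_extension (f t) \o k t) &
           forall t,
             (sup_dist (h t) (inverse_limit_proj (f t) 0%N) < e%:E)%E]) /\
  (forall n : nat, manifold R n X ->
     (forall t, f t @^-1` manifold_boundary R n X =
                manifold_boundary R n X) ->
     forall t,
       manifold_boundary R n (inverse_limit (f t)) =
       [set x | manifold_boundary R n X (inverse_limit_proj (f t) 0%N x)]).
Proof.
split=> [e e0|n _ fbd t].
  (* Strict pointwise bounds give only a weak bound on the supremum, hence the half. *)
  have e2 : 0 < e / 2 by rewrite divr_gt0.
  have [h [k [G [hk chk he _ _]]]] :=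
    near_isotopy_inverse_limit cptX cptI nif e2.
  exists h, k; split => // t; apply: (@le_lt_trans _ _ (e / 2)%:E).
    by apply: sup_dist_le => x; exact: ltW.
  by rewrite lte_fin; lra.
have cbd : closed (manifold_boundary R n X) := @closed_manifold_boundary R n X.
apply/seteqP; split=> x /= bx.
  (* By closedness it suffices to meet every ball about $x_0$; its radius becomes the tolerance for
     [h]. *)
  apply: cbd => P /nbhs_ballP[e /= e0 eP].
  have [h [k [_ [hk _ he _ _]]]] := near_isotopy_inverse_limit cptX cptI nif e0.
  exists (h t x); split; last first.
    by apply: eP; rewrite ballEmdist /= metric_sym; exact: he.
  by apply/(@manifold_boundary_homeo R n) => //; exists (k t); exact: hk.
(* Only the convergence of $G_n(x_n)$ to $h x$ is used from here on, so the tolerance is simply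
   1. *)
have [h [k [G [hk _ _ Ghomeo Gh]]]] :=
  near_isotopy_inverse_limit cptX cptI nif (@ltr01 R).
have bxi i : manifold_boundary R n X (inverse_limit_proj (f t) i x).
  by elim: i => // i IH; rewrite -(fbd t) /= inverse_limit_projS.
apply/(manifold_boundary_homeo n x (h := h t)).
  by exists (k t); exact: hk.
apply: (closed_cvg _ cbd) (Gh t x); apply: nearW => i.
by apply/manifold_boundary_homeo.
Qed.
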